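(* Let $G$ be a finitely generated group that fits in an exact sequence \[ 1\to L\to G\to\mathbb{Z}\to1, \] where $L$ is locally normally finite. Then $G$ has Shalom's property $H_{\mathrm{T}}$, and hence property $H_{\mathrm{FD}}$.
   Context: A group $L$ is locally normally finite if every finite subset of $L$ is contained in a finite normal subgroup of $L$. For a unitary representation $\pi:G\to\mathcal{U}(\mathcal{H})$, a $1$-cocycle is a map $b:G\to\mathcal{H}$ with $b(gh)=b(g)+\pi_g b(h)$; a $1$-coboundary is one of the form $b(g)=v-\pi_g v$. The first reduced cohomology $\overline{H}^1(G,\pi)$ is the space of $1$-cocycles modulo the closure (for uniform convergence on finite subsets) of the $1$-coboundaries. A finitely generated group $G$ has property $H_{\mathrm{FD}}$ (resp. $H_{\mathrm{T}}$) if every unitary representation $\pi$ of $G$ with $\overline{H}^1(G,\pi)\neq 0$ admits a nonzero finite-dimensional subrepresentation (resp. a nonzero $G$-invariant vector). *)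

(* Defs.v *)
(* Groups: mathcomp's (possibly infinite) [groupType] from
   boot/monoid.v.  Scalars: the complex numbers C := R[i] over the Stdlib
   reals R (a realType, via Rstruct). *)
From HB Require Import structures.
From mathcomp Require Import all_boot all_order all_algebra.
From mathcomp Require Import complex.
From mathcomp Require Import Rstruct.
Set Implicit Arguments. Unset Strict Implicit. Unset Printing Implicit Defensive.
Import GRing.Theory Num.Theory.
Local Open Scope ring_scope.

Definition C : numClosedFieldType := (Rdefinitions.R)[i].

(* ---------- group-theoretic notions ---------- *)
Section Groups.
Variable G : groupType.
Local Open Scope group_scope.

Definition subgroup_pred (P : G -> Prop) : Prop :=
  P 1 /\ (forall x y, P x -> P y -> P (x * y)) /\ (forall x, P x -> P x^-1).

(* g lies in the subgroup generated by the elements of S *)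
Definition in_generated (S : seq G) (g : G) : Prop :=
  forall P : G -> Prop, subgroup_pred P -> (forall s, s \in S -> P s) -> P g.

Definition finitely_generated : Prop :=
  exists S : seq G, forall g, in_generated S g.

(* A subgroup L (given as a predicate) is locally normally finite: every finite
   subset of L is contained in a finite subgroup N of L that is normal in L. *)
Definition locally_normally_finite (L : G -> Prop) : Prop :=
  forall s : seq G, (forall x, x \in s -> L x) ->
  exists n : seq G,
    [/\ (forall x, x \in n -> L x),
        subgroup_pred (fun x => x \in n),
        (forall y x, L y -> x \in n -> (y^-1 * x * y) \in n) &
        (forall x, x \in s -> x \in n)].

(* G fits in an exact sequence 1 -> L -> G -> Z -> 1: there is a surjective
   homomorphism phi : G -> Z whose kernel is L. *)
Definition Z_extension_with_kernel (L : G -> Prop) : Prop :=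
  exists phi : G -> int,
    [/\ (forall x y, phi (x * y) = (phi x + phi y)%R),
        (forall z : int, exists x, phi x = z) &
        (forall x, L x <-> phi x = 0%R)].
End Groups.

(* ---------- complex Hilbert spaces ---------- *)
Section Hilbert.
Variable V : lmodType C.
Variable ip : V -> V -> C.   (* inner product, linear in the first argument *)

Definition normsq (v : V) : C := ip v v.

Definition is_hilbert : Prop :=
  [/\ (forall a u v w, ip (a *: u + v) w = a * ip u w + ip v w),
      (forall u v, ip u v = (ip v u)^*),
      (forall v, 0 <= ip v v),
      (forall v, ip v v = 0 -> v = 0) &
      (* completeness: every Cauchy sequence converges *)
      (forall u : nat -> V,
         (forall eps : C, 0 < eps -> exists N, forall m n,
             (N <= m)%N -> (N <= n)%N -> normsq (u m - u n) < eps) ->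
         exists l : V, forall eps : C, 0 < eps -> exists N, forall n,
             (N <= n)%N -> normsq (u n - l) < eps)].
End Hilbert.

Section Representations.
Variable G : groupType.
Variable V : lmodType C.
Variable ip : V -> V -> C.
Variable pi : G -> V -> V.

(* pi is a unitary representation of G on V *)
Definition is_unitary_rep : Prop :=
  [/\ (forall g a u v, pi g (a *: u + v) = a *: pi g u + pi g v),
      (forall v, pi 1%g v = v),
      (forall g h v, pi (g * h)%g v = pi g (pi h v)),
      (forall g u v, ip (pi g u) (pi g v) = ip u v) &
      (forall g w, exists v, pi g v = w)].

Definition is_cocycle (b : G -> V) : Prop :=
  forall g h, b (g * h)%g = b g + pi g (b h).

(* b lies in the closure of the coboundaries for the topology of uniform
   convergence on finite subsets of G *)
Definition in_closure_coboundaries (b : G -> V) : Prop :=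
  forall (F : seq G) (eps : C), 0 < eps ->
  exists v : V, forall g, g \in F -> normsq ip (b g - (v - pi g v)) < eps.

(* the first reduced cohomology is nonzero *)
Definition reduced_H1_nonzero : Prop :=
  exists b : G -> V, is_cocycle b /\ ~ in_closure_coboundaries b.

Definition has_nonzero_invariant_vector : Prop :=
  exists v : V, v != 0 /\ forall g, pi g v = v.

(* nonzero finite-dimensional subrepresentation: the span of a finite family
   s, containing a nonzero vector, and pi(G)-invariant (finite-dimensional
   subspaces are automatically closed). *)
Definition in_span (s : seq V) (w : V) : Prop :=
  exists c : 'I_(size s) -> C, w = \sum_(i < size s) c i *: s`_i.

Definition has_nonzero_fd_subrep : Prop :=
  exists s : seq V, (exists2 v, v \in s & v != 0) /\
    forall g v, v \in s -> in_span s (pi g v).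
End Representations.

(* Shalom's properties H_T and H_FD (for a finitely generated group G) *)
Definition property_HT (G : groupType) : Prop :=
  forall (V : lmodType C) (ip : V -> V -> C) (pi : G -> V -> V),
    is_hilbert ip -> is_unitary_rep ip pi ->
    reduced_H1_nonzero ip pi -> has_nonzero_invariant_vector pi.

Definition property_HFD (G : groupType) : Prop :=
  forall (V : lmodType C) (ip : V -> V -> C) (pi : G -> V -> V),
    is_hilbert ip -> is_unitary_rep ip pi ->
    reduced_H1_nonzero ip pi -> has_nonzero_fd_subrep pi.

(* Main.v *)
(* Choose t in G mapping to 1 in Z and a finite subgroup F of L, normal in L,
   with G = <t, F>. By normality of F, the set B_k = F F^t ... F^(t^k) is a
   finite subgroup, and all its elements have word length O(k). Given a cocycle
   b, let alpha(g) v = b(g) + pi(g) v be the associated affine action, and let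
   Q_k be the set of displacements alpha(t) w - w of the points w fixed by B_k.
   The Q_k are affine subspaces, decreasing in k, and averaging over t-translates
   of a B_2k-fixed point shows that all of them meet a common ball. Hence
   near-minimal elements of the Q_k converge to some vector q. Elements of
   Q_(k+1) are B_k-invariant, so q is F-invariant; moving a point w with
   displacement x by x/2 replaces x by (x + pi(t) x)/2, so minimality makes q
   invariant under t. Without nonzero invariant vectors q = 0, which means that
   alpha has almost fixed points, i.e. b is a limit of coboundaries. *)
From HB Require Import structures.
Require Import Defs.
From mathcomp Require Import all_boot all_order all_algebra.
From mathcomp Require Import complex Rstruct reals boolp ring lra zify.
Set Implicit Arguments. Unset Strict Implicit. Unset Printing Implicit Defensive.
Import Order.TTheory GRing.Theory Num.Theory.
Local Open Scope ring_scope.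

Notation R := Rdefinitions.R.

(** * The real Hilbert space underlying [V] *)

Lemma Re_conj (z : C) : complex.Re z^* = complex.Re z.
Proof. by case: z. Qed.

Section RealHilbert.
Variables (V : lmodType C) (ip : V -> V -> C).
Hypothesis Hip : is_hilbert ip.

Definition rip (u v : V) : R := complex.Re (ip u v).
(** The squared norm: bounds take the form [nrm v <= r ^+ 2] with [0 <= r], which keeps square roots
    out. *)
Definition nrm (v : V) : R := rip v v.

Definition rscale (a : R) (v : V) : V := (a%:C%C : C) *: v.
Local Infix "*^" := rscale (at level 40).

Lemma ripC u v : rip u v = rip v u.
Proof. by case: Hip => _ H _ _ _; rewrite /rip H Re_conj. Qed.

Lemma ripDl u v w : rip (u + v) w = rip u w + rip v w.
Proof.
case: Hip => H _ _ _ _; rewrite /rip -[u in LHS]scale1r H mul1r.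
by case: (ip u w) (ip v w) => ? ? [].
Qed.

Lemma rip0l w : rip 0 w = 0.
Proof. by apply: (@addrI _ (rip 0 w)); rewrite -ripDl !addr0. Qed.

Lemma ripZl a u w : rip (a *^ u) w = a * rip u w.
Proof.
case: Hip => H _ _ _ _.
have ip0 : ip 0 w = 0.
  by apply: (@addrI _ (ip 0 w)); rewrite addr0 -[in RHS](addr0 (0 : V)) -[0 in X in _ = ip (X + _) _]scale1r H mul1r.
rewrite /rip /rscale -[_ *: u]addr0 H ip0 addr0.
by case: (ip u w) => x y /=; rewrite mul0r subr0.
Qed.

Lemma ripNl u w : rip (- u) w = - rip u w.
Proof. by apply: (@addrI _ (rip u w)); rewrite -ripDl !subrr rip0l. Qed.

Lemma ripDr u v w : rip w (u + v) = rip w u + rip w v.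
Proof. by rewrite ripC ripDl !(ripC w). Qed.
Lemma ripNr u w : rip w (- u) = - rip w u.
Proof. by rewrite ripC ripNl (ripC w). Qed.
Lemma ripZr a u w : rip w (a *^ u) = a * rip w u.
Proof. by rewrite ripC ripZl (ripC w). Qed.

Definition ripE := (ripDl, ripDr, ripNl, ripNr, ripZl, ripZr).

Lemma normsqE v : normsq ip v = (nrm v)%:C%C.
Proof.
case: Hip => _ _ H _ _; have := ger0_Im (H v).
by rewrite /nrm /rip /normsq; case: (ip v v) => a b /= ->.
Qed.

Lemma nrm_ge0 v : 0 <= nrm v.
Proof. by case: Hip => _ _ H _ _; have := H v; rewrite -/(normsq ip v) normsqE ler0c. Qed.

Lemma nrm0_eq0 v : nrm v = 0 -> v = 0.
Proof. by case: Hip => _ _ _ H _ v0; apply: H; rewrite -/(normsq ip v) normsqE v0. Qed.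

Lemma nrm0 : nrm 0 = 0. Proof. exact: rip0l. Qed.

Lemma nrmN v : nrm (- v) = nrm v.
Proof. by rewrite /nrm !ripE opprK. Qed.

Lemma nrmZ a v : nrm (a *^ v) = a ^+ 2 * nrm v.
Proof. by rewrite /nrm !ripE mulrA -expr2. Qed.

(** The parallelogram law, arranged so that two short vectors whose midpoint is not much shorter are
    seen to be close. *)
Lemma nrm_midpoint u v :
  nrm (u - v) = 2 * nrm u + 2 * nrm v - 4 * nrm (2^-1 *^ (u + v)).
Proof. by rewrite /nrm !ripE (ripC v u); field. Qed.

Lemma nrmD_le u v : nrm (u + v) <= 2 * nrm u + 2 * nrm v.
Proof. by have := nrm_ge0 (u - v); rewrite /nrm !ripE (ripC v u); lra. Qed.

(* The triangle inequality for the norm, without square roots. *)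
Lemma nrmD_sqr u v r s : 0 <= r -> 0 <= s ->
  nrm u <= r ^+ 2 -> nrm v <= s ^+ 2 -> nrm (u + v) <= (r + s) ^+ 2.
Proof.
rewrite le_eqVlt => /orP[/eqP <- _|r0].
  rewrite expr0n /= => u0 v0; rewrite add0r (_ : u = 0) ?add0r//.
  by apply: nrm0_eq0; apply/eqP; rewrite eq_le u0 nrm_ge0.
rewrite le_eqVlt => /orP[/eqP <- u0|s0 ur vs].
  rewrite expr0n /= => v0; rewrite addr0 (_ : v = 0) ?addr0//.
  by apply: nrm0_eq0; apply/eqP; rewrite eq_le v0 nrm_ge0.
have rs0 : 0 < r * s by apply: mulr_gt0.
(* Cauchy-Schwarz in disguise: expanding this square gives [rip u v <= r * s] after division by
   [r * s], hence the degenerate cases above. *)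
have := nrm_ge0 (s *^ u - r *^ v).
have e1 : nrm (s *^ u - r *^ v) = s ^+ 2 * nrm u + r ^+ 2 * nrm v - 2 * (r * s) * rip u v.
  by rewrite /nrm !ripE (ripC v u); ring.
have -> : nrm (u + v) = nrm u + nrm v + 2 * rip u v.
  by rewrite /nrm !ripE (ripC v u); ring.
rewrite e1 => e2.
have h1 : s ^+ 2 * nrm u <= s ^+ 2 * r ^+ 2 by rewrite ler_pM2l ?exprn_gt0.
have h2 : r ^+ 2 * nrm v <= r ^+ 2 * s ^+ 2 by rewrite ler_pM2l ?exprn_gt0.
have h3 : rip u v <= r * s.
  rewrite -(ler_pM2l rs0); lra.
lra.
Qed.

Lemma nrm_sum_sqr (I : eqType) (s : seq I) (f : I -> V) (r : R) : 0 <= r ->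
  (forall i, i \in s -> nrm (f i) <= r ^+ 2) ->
  nrm (\sum_(i <- s) f i) <= ((size s)%:R * r) ^+ 2.
Proof.
move=> r0; elim: s => [|i s IH] H.
  by rewrite big_nil nrm0 mul0r expr0n.
rewrite big_cons /= -natr1 mulrDl mul1r addrC.
apply: nrmD_sqr => //; first by rewrite mulr_ge0 ?ler0n.
  by apply: IH => j js; apply: H; rewrite inE js orbT.
by apply: H; rewrite inE eqxx.
Qed.

Lemma nrm_complete (u : nat -> V) :
  (forall eps, 0 < eps -> exists N, forall m n,
     (N <= m)%N -> (N <= n)%N -> nrm (u m - u n) < eps) ->
  exists l, forall eps, 0 < eps -> exists N, forall n, (N <= n)%N -> nrm (u n - l) < eps.
Proof.
move=> H; case: Hip => _ _ _ _ /(_ u)[].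
  (* Positivity in [C] forces a zero imaginary part, so [eps] is a real bound. *)
  move=> eps; rewrite ltcE /= => /andP[/eqP ei /H[N HN]]; exists N => m n Nm Nn.
  by rewrite normsqE ltcE /= ei eqxx HN.
move=> l Hl; exists l => eps e0.
have [|N HN] := Hl (eps%:C%C); first by rewrite ltcE /= eqxx.
by exists N => n /HN; rewrite normsqE ltcR.
Qed.

End RealHilbert.

(** * Generators of the extension and the finite subgroups $B_k$ *)

Section Blocks.
Variable G : groupType.
Local Open Scope group_scope.

Lemma subgroup_predX (P : G -> Prop) x n : subgroup_pred P -> P x -> P (x ^+ n).
Proof.
move=> [P1 [PM _]] Px; elim: n => [|n IH]; first by rewrite expg0.
by rewrite expgS; apply: PM.
Qed.

(** Each generator of [G] is a power of [t] times an element of [L]; the finitely many elements of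
    [L] so obtained lie in a finite subgroup [F] normal in [L]. Generation is phrased as an
    induction principle over subgroups. *)
Lemma Z_extension_generators (L : G -> Prop) :
  finitely_generated G -> Z_extension_with_kernel L -> locally_normally_finite L ->
  exists (t : G) (F : seq G), subgroup_pred L /\
    [/\ (forall x, L x -> L (x ^ t)),
    (forall x, x \in F -> L x), subgroup_pred (fun x => x \in F),
    (forall y x, L y -> x \in F -> x ^ y \in F) &
    (forall P, subgroup_pred P -> P t -> (forall x, x \in F -> P x) -> forall g, P g)].
Proof.
move=> [S genS] [phi [phiM phi_onto Lphi]] finL.
have phi1 : phi 1 = 0%R by apply: (@addrI _ (phi 1)); rewrite -phiM mulg1 addr0.
have phiV x : phi x^-1 = (- phi x)%R.
  by apply: (@addrI _ (phi x)); rewrite -phiM mulgV subrr.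
have subL : subgroup_pred L.
  split; first by apply/Lphi.
  split=> [x y /Lphi x0 /Lphi y0|x /Lphi x0]; apply/Lphi.
    by rewrite phiM x0 y0.
  by rewrite phiV x0 oppr0.
have [t t1] := phi_onto 1%R.
have phiX n : phi (t ^+ n) = Posz n.
  by elim: n => [|n IH]; rewrite ?expg0// expgS phiM IH t1.
have lift (z : int) : exists2 p, phi p = z & forall P, subgroup_pred P -> P t -> P p.
  case: z => n.
    by exists (t ^+ n); rewrite ?phiX// => P PP Pt; apply: subgroup_predX.
  exists (t ^+ n.+1)^-1; rewrite ?phiV ?phiX ?NegzE// => P PP Pt.
  by apply: PP.2.2; apply: subgroup_predX.
have [F0 F0L genF0] : exists2 F0 : seq G, (forall x, x \in F0 -> L x) &
    forall P, subgroup_pred P -> P t -> (forall x, x \in F0 -> P x) ->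
      forall s, s \in S -> P s.
  elim: {genS} S => [|s S [F0 F0L genF0]]; first by exists [::].
  have [p ps Pp] := lift (phi s).
  exists (p^-1 * s :: F0) => [x|P PP Pt PF x].
    rewrite inE => /orP[/eqP ->|/F0L//].
    by apply/Lphi; rewrite phiM phiV ps addNr.
  rewrite inE => /orP[/eqP ->|xS].
    rewrite -(mulVKg p s); apply: PP.2.1; first exact: Pp.
    by apply: PF; rewrite inE eqxx.
  by apply: (genF0 P) => // y yF; apply: PF; rewrite inE yF orbT.
have [F [FL subF nF F0F]] := finL _ F0L.
exists t, F; split=> //; split=> // [x /Lphi x0|y x Ly xF|P PP Pt PF g].
- by apply/Lphi; rewrite conjgE !phiM phiV x0 add0r addNr.
- by rewrite conjgE mulgA; apply: nF.
- apply: (genS g P PP); apply: (genF0 P) => // x /F0F; exact: PF.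
Qed.

Variables (L : G -> Prop) (t : G) (F : seq G).
Hypotheses (subL : subgroup_pred L) (Lt : forall x, L x -> L (x ^ t)).
Hypotheses (FL : forall x, x \in F -> L x) (subF : subgroup_pred (fun x => x \in F)).
Hypothesis nF : forall y x, L y -> x \in F -> x ^ y \in F.

(** Lists $B_k = F F^t \cdots F^{t^k}$, possibly with repetitions. *)
Fixpoint block k : seq G :=
  if k is k'.+1 then [seq f * y ^ t | f <- F, y <- block k'] else F.

Lemma blockSP k x :
  reflect (exists f y, [/\ f \in F, y \in block k & x = f * y ^ t]) (x \in block k.+1).
Proof.
apply: (iffP allpairsP) => [[[f y] [/= ? ? ?]]|[f [y [? ? ?]]]]; first by exists f, y.
by exists (f, y).
Qed.

Lemma block_sub_L k x : x \in block k -> L x.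
Proof.
elim: k x => [|k IH] x; first exact: FL.
by case/blockSP => f [y [fF /IH/Lt Ly ->]]; apply: subL.2.1 => //; apply: FL.
Qed.

(** $B_{k+1} = F B_k^t$, where $B_k^t$ lies in [L] and therefore normalizes [F]: factors from [F]
    can be moved to the left by conjugation. *)
Lemma block_subgroup k : subgroup_pred (fun x => x \in block k).
Proof.
case: (subF) => F1 [FM FV]; case: (subL) => L1 [LM LV].
elim: k => [//|k [B1 [BM BV]]]; split.
  by apply/blockSP; exists 1, 1; rewrite conj1g mulg1.
split.
  move=> _ _ /blockSP[f [y [fF yB ->]]] /blockSP[f' [y' [fF' yB' ->]]].
  apply/blockSP; exists (f * f' ^ (y ^ t)^-1), (y * y'); split; last first.
  - by rewrite conjMg; move: (y ^ t) (y' ^ t) => a c; rewrite conjgE invgK !mulgA mulgVK.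
  - exact: BM.
  - by apply: FM => //; apply: nF => //; apply/LV/Lt/(block_sub_L yB).
move=> _ /blockSP[f [y [fF yB ->]]].
apply/blockSP; exists (f^-1 ^ (y ^ t)), y^-1; split; last first.
- by rewrite invgM (conjVg y); move: (y ^ t) => a; rewrite conjgE mulgA mulgK.
- exact: BV.
- by apply: nF; [apply/Lt/(block_sub_L yB)|apply: FV].
Qed.

Lemma block_mono k x : x \in block k -> x \in block k.+1.
Proof.
elim: k x => [|k IH] x.
  move=> xF; apply/blockSP; exists x, 1; rewrite conj1g mulg1; split=> //.
  exact: subF.1.
by case/blockSP => f [y [fF /IH yB ->]]; apply/blockSP; exists f, y.
Qed.

Lemma block_le k m x : (k <= m)%N -> x \in block k -> x \in block m.
Proof.
move/subnK <-; elim: (m - k)%N => // n IH /IH; rewrite addSn; exact: block_mono.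
Qed.

Lemma block_conj k x : x \in block k -> x ^ t \in block k.+1.
Proof.
by move=> xB; apply/blockSP; exists 1, x; rewrite mul1g; split=> //; exact: subF.1.
Qed.

Lemma block_conjX i k x : x \in block k -> x ^ (t ^+ i) \in block (k + i)%N.
Proof.
elim: i => [|i IH] xB; first by rewrite expg0 conjg1 addn0.
by rewrite expgSr conjgM addnS; apply: block_conj; apply: IH.
Qed.

End Blocks.

(* Near-minimal vectors in a decreasing sequence of sets *)
Local Infix "*^" := rscale (at level 40).

Section NestedConvex.
Variables (V : lmodType C) (ip : V -> V -> C).
Hypothesis Hip : is_hilbert ip.
Local Notation nrm := (nrm ip).

(** The infima of [nrm] on the [Q k] increase to a finite limit [sup E], and the parallelogram law
    does the rest. The conclusion allows arbitrary [u] and [v] with midpoint in [Q K], so that it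
    serves both for the Cauchy property and for invariance under [t]. *)
Lemma nested_convex_min (Q : nat -> V -> Prop) (D : R) :
  (forall k m x, (k <= m)%N -> Q m x -> Q k x) ->
  (forall k, exists2 x, Q k x & nrm x <= D) ->
  exists x : nat -> V, (forall k, Q k (x k)) /\
    forall eps, 0 < eps -> exists (K : nat) (M : R),
      (forall n, (K <= n)%N -> nrm (x n) < M) /\
      (forall u v, nrm u < M -> nrm v < M -> Q K (2^-1 *^ (u + v)) ->
         nrm (u - v) < eps).
Proof.
move=> Qle Qbd.
pose E : classical_sets.set R := fun r => exists k, forall x, Q k x -> r <= nrm x.
have supE : classical_sets.has_sup E.
  split; first by exists 0, 0%N => x _; apply: nrm_ge0.
  exists D => r [k Hk]; have [x Qx xD] := Qbd k.
  exact: le_trans (Hk x Qx) xD.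
have near k : exists x, Q k x /\ nrm x < sup E + k.+1%:R^-1.
  apply: contrapT => H.
  have : E (sup E + k.+1%:R^-1).
    exists k => x Qx; rewrite leNgt; apply/negP => xlt; apply: H; by exists x.
  move/(sup_upper_bound supE); rewrite gerDl leNgt invr_gt0 ltr0n //.
have [x Hx] := choice near.
exists x; split=> [k|eps e0]; first by case: (Hx k).
have e8 : 0 < eps / 8 by lra.
have [r [k Hk] rE] := sup_adherent e8 supE.
have [N HN] : exists N : nat, (N.+1%:R)^-1 < eps / 8.
  exists (Num.truncn (eps / 8)^-1).
  by rewrite invf_plt ?posrE ?ltr0n //; apply: truncnS_gt.
(* The midpoint has [nrm] above [sup E - eps / 8], so the parallelogram law leaves less than
   [4 * (eps / 8) + 4 * (eps / 8) = eps]. *)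
exists (maxn k N), (sup E + eps / 8); split=> [n|u v uM vM mid].
  rewrite geq_max => /andP[_ Nn]; have [_ /lt_trans->//] := Hx n.
  rewrite ltrD2l; apply: le_lt_trans HN.
  by rewrite lef_pV2 ?posrE ?ltr0n // ler_nat ltnS.
rewrite nrm_midpoint //.
have := Hk _ (Qle _ _ _ (leq_maxl k N) mid).
lra.
Qed.
End NestedConvex.

(** * The affine isometric action attached to a cocycle *)

Section AffineAction.
Variables (G : groupType) (V : lmodType C) (ip : V -> V -> C) (pi : G -> V -> V).
Hypotheses (Hip : is_hilbert ip) (Hpi : is_unitary_rep ip pi).
Variable b : G -> V.
Hypothesis Hb : is_cocycle pi b.
Local Notation nrm := (nrm ip).

Lemma repD g u v : pi g (u + v) = pi g u + pi g v.
Proof. by case: Hpi => H _ _ _ _; rewrite -{1}[u]scale1r H scale1r. Qed.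

Lemma rep0 g : pi g 0 = 0.
Proof. by apply: (@addrI _ (pi g 0)); rewrite -repD !addr0. Qed.

Lemma repN g v : pi g (- v) = - pi g v.
Proof. by apply: (@addrI _ (pi g v)); rewrite -repD !subrr rep0. Qed.

Lemma repZ g a v : pi g (a *^ v) = a *^ pi g v.
Proof. by case: Hpi => H _ _ _ _; rewrite /rscale -[_ *: v]addr0 H rep0 addr0. Qed.

Lemma rep_sum g (I : Type) (s : seq I) (f : I -> V) :
  pi g (\sum_(i <- s) f i) = \sum_(i <- s) pi g (f i).
Proof. exact: (big_morph (pi g) (repD g) (rep0 g)). Qed.

Lemma nrm_rep g v : nrm (pi g v) = nrm v.
Proof. by case: Hpi => _ _ _ H _; rewrite /nrm /rip H. Qed.

Lemma repM g h v : pi (g * h)%g v = pi g (pi h v).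
Proof. by case: Hpi. Qed.

Lemma rep1 v : pi 1%g v = v.
Proof. by case: Hpi. Qed.

Lemma cocycle1 : b 1%g = 0.
Proof. by have := Hb 1%g 1%g; rewrite mulg1 rep1 -[LHS]addr0 => /addrI. Qed.

Definition aff (g : G) (v : V) : V := b g + pi g v.

Lemma affM g h v : aff (g * h)%g v = aff g (aff h v).
Proof. by rewrite /aff Hb repD repM addrA. Qed.

Lemma aff_average g (I : Type) (s : seq I) (f : I -> V) : (0 < size s)%N ->
  aff g ((size s)%:R^-1 *^ \sum_(i <- s) f i) =
  (size s)%:R^-1 *^ \sum_(i <- s) aff g (f i).
Proof.
move=> s0; rewrite /aff big_split /= -rep_sum /rscale scalerDr -!/(rscale _ _) repZ.
congr (_ + _); rewrite big_const_seq count_predT iter_addr addr0.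
rewrite /rscale -scaler_nat scalerA fmorphV rmorph_nat.
by rewrite mulVf ?scale1r // pnatr_eq0 -lt0n.
Qed.

(** Equals [b g - (v - pi g v)], the error in approximating [b] by the coboundary of [v]. *)
Definition disp (g : G) (v : V) : V := aff g v - v.

Lemma disp_midpoint g u v :
  disp g (2^-1 *^ (u + v)) = 2^-1 *^ (disp g u + disp g v).
Proof.
have := @aff_average g _ [:: u; v] id isT.
rewrite /= !big_cons !big_nil !addr0 /disp => ->.
by rewrite /rscale -scalerBr opprD addrACA.
Qed.

Lemma dispD g w u : disp g (w + u) = disp g w + (pi g u - u).
Proof. by rewrite /disp /aff repD opprD (addrA (b g)) addrACA. Qed.

Lemma dispM g h v : disp (g * h)%g v = disp g v + pi g (disp h v).
Proof.
rewrite /disp affM repD repN; set u := aff h v.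
rewrite /aff [b g + pi g v - v]addrAC -[RHS]addrA.
by rewrite [pi g v + _]addrC subrK addrAC.
Qed.

Definition fixed (B : seq G) (w : V) : Prop := forall g, g \in B -> aff g w = w.

(** The vectors [b x] form the orbit of 0 under [aff], and the barycentre of a finite orbit is
    fixed. Duplicates are removed so that left translation permutes the list. *)
Lemma fixed_average (B : seq G) (c : R) : subgroup_pred (fun x => x \in B) ->
  0 <= c -> (forall x, x \in B -> nrm (b x) <= c ^+ 2) ->
  exists2 v, fixed B v & nrm v <= c ^+ 2.
Proof.
move=> [B1 [BM BV]] c0 Bc; set s := undup B.
have sE x : (x \in s) = (x \in B) by rewrite mem_undup.
have s0 : (0 < size s)%N by have := sE 1%g; rewrite B1; case: (s).
exists ((size s)%:R^-1 *^ \sum_(x <- s) b x).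
  move=> g gB; rewrite aff_average //; congr (_ *^ _).
  rewrite (eq_bigr (fun x => b (g * x)%g)); last by move=> x _; rewrite Hb.
  rewrite -(big_map (fun x => g * x)%g xpredT b); apply: perm_big.
  apply: uniq_perm; rewrite ?(map_inj_uniq (mulgI g)) ?undup_uniq // => x.
  apply/mapP/idP => [[y ys ->]|xs]; first by rewrite sE BM // -sE.
  by exists (g^-1 * x)%g; rewrite ?mulVKg // sE BM ?BV // -sE.
have sR : 0 < (size s)%:R :> R by rewrite ltr0n.
rewrite nrmZ // exprVn mulrC ler_pdivrMr ?exprn_gt0 // -exprMn [c * _]mulrC.
by apply: nrm_sum_sqr => // x; rewrite sE; apply: Bc.
Qed.

Lemma cocycle_sqrD g h r s : 0 <= r -> 0 <= s ->
  nrm (b g) <= r ^+ 2 -> nrm (b h) <= s ^+ 2 -> nrm (b (g * h)%g) <= (r + s) ^+ 2.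
Proof. by move=> r0 s0 gr hs; rewrite Hb; apply: nrmD_sqr => //; rewrite nrm_rep. Qed.

Lemma nrm_sqr_bound v : exists2 r, 0 <= r & nrm v <= r ^+ 2.
Proof.
exists (1 + nrm v); have := nrm_ge0 Hip v; nra.
Qed.

Lemma cocycle_seq_bound (s : seq G) :
  exists2 r, 0 <= r & forall g, g \in s -> nrm (b g) <= r ^+ 2.
Proof.
elim: s => [|g s [r r0 IH]]; first by exists 0.
have [r' r'0 Hr'] := nrm_sqr_bound (b g).
exists (r + r'); first by rewrite addr_ge0.
move=> h; rewrite inE => /orP[/eqP ->|/IH hr].
  by apply: le_trans Hr' _; rewrite lerXn2r ?nnegrE ?addr_ge0 // lerDr.
by apply: le_trans hr _; rewrite lerXn2r ?nnegrE ?addr_ge0 // lerDl.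
Qed.

Lemma cocycleX_bound g r n : 0 <= r -> nrm (b g) <= r ^+ 2 ->
  nrm (b (g ^+ n)%g) <= (n%:R * r) ^+ 2.
Proof.
move=> r0 gr; elim: n => [|n IH]; first by rewrite expg0 cocycle1 nrm0 // mul0r expr0n.
rewrite expgS -natr1 mulrDl mul1r addrC.
by apply: cocycle_sqrD => //; rewrite mulr_ge0.
Qed.

(** Reduces almost fixedness under [G] to the generators [t] and [F]. *)
Lemma almost_fixed_subgroup (w : nat -> V) : subgroup_pred (fun g =>
  forall eps, 0 < eps -> exists N, forall n, (N <= n)%N -> nrm (disp g (w n)) < eps).
Proof.
split=> [eps e0|].
  exists 0%N => n _; rewrite /disp /aff cocycle1 rep1 add0r subrr nrm0 //.
split=> [g h Hg Hh eps e0|g Hg eps /Hg[N HN]].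
  have e4 : 0 < eps / 4 by lra.
  have [N HN] := Hg _ e4; have [M HM] := Hh _ e4.
  exists (maxn N M) => n; rewrite geq_max => /andP[/HN hN /HM hM].
  rewrite dispM; apply: le_lt_trans (nrmD_le Hip _ _) _.
  by rewrite nrm_rep; lra.
exists N => n /HN; rewrite -(nrm_rep g^-1) -(nrmN Hip).
suff -> : disp g^-1%g (w n) = - pi g^-1%g (disp g (w n)) by [].
have := dispM g^-1%g g (w n); rewrite mulVg {1}/disp /aff cocycle1 rep1 add0r subrr.
by move/eqP; rewrite eq_sym addr_eq0 => /eqP.
Qed.

Lemma stabilizer_subgroup v : subgroup_pred (fun g => pi g v = v).
Proof.
split; first exact: rep1.
split=> [g h gv hv|g gv]; first by rewrite repM hv.
by rewrite -{1}gv -repM mulVg rep1.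
Qed.

Lemma limit_invariant g (x : nat -> V) q :
  (forall eps, 0 < eps -> exists N, forall n, (N <= n)%N -> nrm (x n - q) < eps) ->
  (forall eps, 0 < eps -> exists N, forall n, (N <= n)%N -> nrm (x n - pi g (x n)) < eps) ->
  pi g q = q.
Proof.
move=> xq xg; apply/eqP; rewrite eq_sym -subr_eq0; apply/eqP/(nrm0_eq0 Hip).
apply/eqP; rewrite eq_le nrm_ge0 // andbT leNgt; apply/negP => e0.
set e := nrm _ in e0.
(* The three terms below contribute 4, 4 and 2 times at most [e / 16], in total less than [e]. *)
have e8 : 0 < e / 16 by lra.
have [N HN] := xq _ e8; have [M HM] := xg _ e8.
have hN := HN _ (leq_maxl N M); have hM := HM _ (leq_maxr N M).
set y := x _ in hN hM.
have : e <= 2 * (2 * nrm (q - y) + 2 * nrm (y - pi g y)) + 2 * nrm (pi g (y - q)).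
  rewrite /e (_ : q - pi g q = ((q - y) + (y - pi g y)) + pi g (y - q)).
    apply: le_trans (nrmD_le Hip _ _) _; rewrite lerD2r ler_pM2l //.
    exact: nrmD_le.
  by rewrite addrA subrK repD repN addrA subrK.
by rewrite nrm_rep -(nrmN Hip (q - y)) opprB; lra.
Qed.

(** * Almost fixed points for the extension *)

Variables (L : G -> Prop) (t : G) (F : seq G).
Hypotheses (subL : subgroup_pred L) (Lt : forall x, L x -> L (x ^ t)%g).
Hypotheses (FL : forall x, x \in F -> L x) (subF : subgroup_pred (fun x => x \in F)).
Hypothesis nF : forall y x, L y -> x \in F -> (x ^ y)%g \in F.
Hypothesis genF : forall P, subgroup_pred P -> P t -> (forall x, x \in F -> P x) -> forall g, P g.
Local Notation block := (block t F).

Lemma cocycle_block_bound : exists2 c, 0 <= c &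
  forall k x, x \in block k -> nrm (b x) <= (k.+1%:R * c) ^+ 2.
Proof.
have [c c0 Hc] := cocycle_seq_bound (t :: t^-1%g :: F).
have ct : nrm (b t) <= c ^+ 2 by apply: Hc; rewrite inE eqxx.
have ctV : nrm (b t^-1%g) <= c ^+ 2 by apply: Hc; rewrite !inE eqxx orbT.
have cF f : f \in F -> nrm (b f) <= c ^+ 2 by move=> fF; apply: Hc; rewrite !inE fF !orbT.
(* Passing from [y] to $f t^{-1} y t$ adds three letters, each costing at most [c]. *)
exists (c *+ 3); first by rewrite mulrn_wge0.
elim=> [|k IH] x.
  move/cF => /le_trans; apply; rewrite lerXn2r ?nnegrE ?mulr_ge0 ?mulrn_wge0 //.
  by rewrite mul1r !mulrS; lra.
case/blockSP => f [y [/cF fc /IH yc ->]].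
have k0 : 0 <= k.+1%:R * (c *+ 3) by rewrite mulr_ge0 ?mulrn_wge0.
have -> : k.+2%:R * (c *+ 3) = c + (c + (k.+1%:R * (c *+ 3) + c)) by ring.
rewrite conjgE.
by do 3 (apply: cocycle_sqrD => //; rewrite ?addr_ge0 //).
Qed.

Lemma fixed_le k m w : (k <= m)%N -> fixed (block m) w -> fixed (block k) w.
Proof. by move=> km wm g gk; apply: wm; apply: (block_le subF km gk). Qed.

(** Since $g t^i = t^i g^{t^i}$, translating by $t^i$ costs [i] levels of the filtration; averaging
    over [i <= k] thus starts from level [k + k]. *)
Lemma fixed_affX k i v : fixed (block (k + i)) v -> fixed (block k) (aff (t ^+ i)%g v).
Proof.
move=> vfix g gk; rewrite -affM conjgC affM vfix //.
exact: (block_conjX subF).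
Qed.

(* Averaging alpha(t^i) v over i <= k, where v is fixed by [block (k + k)] and
   has norm O(k), gives points displaced by t by O(k) / (k + 1). *)
Lemma bounded_displacement : exists D, forall k,
  exists2 w, fixed (block k) w & nrm (disp t w) <= D.
Proof.
have [c c0 Hc] := cocycle_block_bound.
have [ct ct0 Hct] := nrm_sqr_bound (b t).
(* After telescoping, the displacement is $1/(k+1)$ times $b(t^{k+1}) + \pi(t^{k+1}) v - v$; the
   three terms have norm at most [k.+1] times [ct], [c + c] and [c + c]. *)
exists ((ct + (c + c) *+ 2) ^+ 2) => k.
have cb x : x \in block (k + k) -> nrm (b x) <= (k.+1%:R * (c + c)) ^+ 2.
  move/Hc => /le_trans; apply; rewrite lerXn2r ?nnegrE ?mulr_ge0 ?addr_ge0 //.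
  rewrite mulrDr -mulrDl ler_wpM2r // -natrD ler_nat; lia.
have cb0 : 0 <= k.+1%:R * (c + c) by rewrite mulr_ge0 ?addr_ge0.
have subB := block_subgroup subL Lt FL subF nF (k + k).
have [v vfix vc] := fixed_average subB cb0 cb.
pose u i := aff (t ^+ i)%g v.
have ufix i : (i < k.+1)%N -> fixed (block k) (u i).
  by move=> ik; apply: fixed_affX; apply: fixed_le vfix; rewrite leq_add2l.
have sz : size (index_iota 0 k.+1) = k.+1 by rewrite size_iota subn0.
have avg g : aff g (k.+1%:R^-1 *^ \sum_(0 <= i < k.+1) u i) =
    k.+1%:R^-1 *^ \sum_(0 <= i < k.+1) aff g (u i).
  by have := @aff_average g _ (index_iota 0 k.+1) u; rewrite sz; apply.
exists (k.+1%:R^-1 *^ \sum_(0 <= i < k.+1) u i).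
  move=> g gk; rewrite avg; congr (_ *^ _); apply: eq_big_nat => i /andP[_ ik].
  exact: ufix.
have -> : disp t (k.+1%:R^-1 *^ \sum_(0 <= i < k.+1) u i) =
    k.+1%:R^-1 *^ (b (t ^+ k.+1)%g + (pi (t ^+ k.+1)%g v - v)).
  rewrite /disp avg /rscale -scalerBr -sumrB; congr (_ *: _).
  under eq_bigr => i _ do rewrite /u -affM -expgS.
  rewrite (telescope_sumr (fun i => aff (t ^+ i)%g v)) //.
  by rewrite expg0 /aff cocycle1 rep1 add0r addrA.
rewrite nrmZ // exprVn mulrC ler_pdivrMr ?exprn_gt0 // -exprMn.
have -> : (ct + (c + c) *+ 2) * k.+1%:R =
  k.+1%:R * ct + (k.+1%:R * (c + c) + k.+1%:R * (c + c)) by ring.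
apply: (nrmD_sqr Hip); rewrite ?mulr_ge0 ?addr_ge0 //.
  exact: cocycleX_bound.
by apply: (nrmD_sqr Hip); rewrite ?nrm_rep ?nrmN.
Qed.

(** Both [w] and [aff t w] are fixed by [block k], and a difference of two fixed points of [aff g]
    is fixed by its linear part [pi g]. *)
Lemma disp_invariant k w : fixed (block k.+1) w ->
  forall g, g \in block k -> pi g (disp t w) = disp t w.
Proof.
move=> wfix g gk.
have e1 : aff g (aff t w) = aff t w.
  by rewrite -affM conjgC affM wfix //; apply: block_conj.
have e2 : aff g w = w by apply: wfix; apply: block_mono.
transitivity (aff g (aff t w) - aff g w); last by rewrite e1 e2.
by rewrite /disp repD repN {2 3}/aff opprD addrACA subrr add0r.
Qed.

Lemma almost_fixed_points :
  (forall v, (forall g, pi g v = v) -> v = 0) ->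
  exists w : nat -> V, forall g eps, 0 < eps ->
    exists N, forall n, (N <= n)%N -> nrm (disp g (w n)) < eps.
Proof.
move=> noinv.
have [D HD] := bounded_displacement.
pose Q k x := exists2 w, fixed (block k) w & disp t w = x.
have Qle k m x : (k <= m)%N -> Q m x -> Q k x.
  by move=> km [w wm <-]; exists w => //; apply: fixed_le wm.
have Qbd k : exists2 x, Q k x & nrm x <= D.
  by have [w wk wD] := HD k; exists (disp t w) => //; exists w.
have [x [Qx Hx]] := nested_convex_min Hip Qle Qbd.
have Qmid k u v : Q k u -> Q k v -> Q k (2^-1 *^ (u + v)).
  move=> [w wk <-] [w' wk' <-]; exists (2^-1 *^ (w + w')).
    move=> g gk; have := @aff_average g _ [:: w; w'] id isT.
    by rewrite /= !big_cons !big_nil !addr0 wk // wk'.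
  exact: disp_midpoint.
have xinv n g : g \in block n -> pi g (x n.+1) = x n.+1.
  by have [w wn <-] := Qx n.+1; apply: disp_invariant.
(* Adding half of [x n.+1] to [w] keeps it fixed by [block n], because [x n.+1] is invariant there;
   one level is lost. *)
have Qshift n : Q n (2^-1 *^ (x n.+1 + pi t (x n.+1))).
  have [w wn wx] := Qx n.+1; exists (w + 2^-1 *^ x n.+1).
    move=> g gn; rewrite /aff repD repZ xinv // addrA.
    by congr (_ + _); apply: wn; apply: block_mono.
  rewrite dispD wx repZ /rscale scalerDr addrC [RHS]addrC -addrA.
  congr (_ + _); apply/eqP; rewrite addrC subr_eq -scalerDl.
  rewrite -rmorphD (_ : 2^-1 + 2^-1 = 1) ?scale1r //; lra.
have [q Hq] : exists q, forall eps, 0 < eps ->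
    exists N, forall n, (N <= n)%N -> nrm (x n - q) < eps.
  apply: (nrm_complete Hip) => eps /Hx[K [M [HM HK]]]; exists K => m n Km Kn.
  by apply: HK; [exact: HM|exact: HM|apply: Qmid; apply: Qle (Qx _)].
have q0 : q = 0.
  apply: noinv; apply: (genF (stabilizer_subgroup q)).
    apply: (limit_invariant Hq) => eps /Hx[K [M [HM HK]]].
    (* [x n.+1] and its image under [pi t] have equal norm and midpoint in [Q n], hence in [Q K] as
       [K <= n]; near-minimality makes them close. *)
    exists K.+1 => -[//|n] Kn; have hn := HM n.+1 (leqW Kn).
    by apply: HK; rewrite ?nrm_rep //; apply: Qle (Qshift n).
  move=> f fF; apply: (limit_invariant Hq) => eps e0.
  exists 1%N => -[//|n] _; rewrite xinv ?subrr ?nrm0 //.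
  exact: (block_le subF (leq0n n)).
(* The points realizing the displacements [x n], which tend to [q = 0], are the almost fixed
   points. *)
have [w Hw] := boolp.choice (fun n => let: ex_intro2 w wk wx := Qx n in
  ex_intro (fun w => fixed (block n) w /\ disp t w = x n) w (conj wk wx)).
exists w; apply: (genF (almost_fixed_subgroup w)).
  move=> eps /Hq[N HN]; exists N => n /HN; rewrite q0 subr0.
  by have [_ ->] := Hw n.
move=> f fF eps e0; exists 0%N => n _; have [wn _] := Hw n.
by rewrite /disp wn ?subrr ?nrm0 //; apply: (block_le subF (leq0n n)).
Qed.

End AffineAction.

(** * From almost fixed points to reduced cohomology *)

Lemma eventually_seq (T : eqType) (s : seq T) (P : T -> nat -> Prop) :
  (forall x, exists N, forall n, (N <= n)%N -> P x n) ->
  exists n, forall x, x \in s -> P x n.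
Proof.
move=> H; suff [N HN] : exists N, forall n, (N <= n)%N -> forall x, x \in s -> P x n.
  by exists N; apply: HN.
elim: s => [|x s [N HN]]; first by exists 0%N.
have [M HM] := H x; exists (maxn N M) => n; rewrite geq_max => /andP[Nn Mn] y.
by rewrite inE => /orP[/eqP ->|]; [apply: HM|apply: HN].
Qed.

Lemma HT_HFD (G : groupType) : property_HT G -> property_HFD G.
Proof.
move=> HT V ip pi Hip Hpi H1; have [v [v0 vinv]] := HT V ip pi Hip Hpi H1.
exists [:: v]; split=> [|g u]; first by exists v; rewrite ?inE.
rewrite inE => /eqP ->; exists (fun=> 1).
by rewrite big_ord1 /= scale1r vinv.
Qed.

Theorem theorem1p1 (G : groupType) (L : G -> Prop) :
  finitely_generated G ->
  Z_extension_with_kernel L ->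
  locally_normally_finite L ->
  property_HT G /\ property_HFD G.
Proof.
move=> fg ext lnf; suff HT : property_HT G by split=> //; apply: HT_HFD.
have [t [F [subL [Lt FL subF nF genF]]]] := Z_extension_generators fg ext lnf.
move=> V ip pi Hip Hpi [b [Hb nclos]]; apply: contrapT => noinv; apply: nclos.
have [|w Hw] := @almost_fixed_points _ _ _ _ Hip Hpi _ Hb _ _ _ subL Lt FL subF nF genF.
  by move=> v vinv; apply/eqP; apply: contrapT => /negP v0; apply: noinv; exists v.
move=> S eps; rewrite ltcE /= => /andP[/eqP eps_im eps0].
have [n Hn] := eventually_seq S (fun g => Hw g _ eps0).
exists (w n) => g gS; rewrite opprB addrA normsqE // ltcE /= eps_im eqxx.
exact: Hn.
Qed.
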